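(* Suppose the plant is open-loop stable, i.e. $A$ is stable. Let $\Lambda\in\mathbb{R}^{n\times n}$ be stable, and let $$\mathsf K^\star=\begin{bmatrix}0&0\\ 0&\Lambda\end{bmatrix}\in\mathcal{C}_n$$ (i.e. $A_{\mathsf K}=\Lambda$, $B_{\mathsf K}=0$, $C_{\mathsf K}=0$). Then $\mathsf K^\star$ is a stationary point of $J_n$ over $\mathcal{C}_n$, and the corresponding Hessian $\operatorname{Hess}_{\mathsf K^\star}$ is either indefinite or zero. Furthermore, suppose $\Lambda$ is diagonalizable, and let $\operatorname{eig}(-\Lambda)$ denote the set of (distinct) eigenvalues of $-\Lambda$. Let $X_{\mathrm{op}}$ and $Y_{\mathrm{op}}$ be the solutions to the Lyapunov equations $$AX_{\mathrm{op}}+X_{\mathrm{op}}A^{\mathsf T}+W=0,\qquad A^{\mathsf T}Y_{\mathrm{op}}+Y_{\mathrm{op}}A+Q=0,$$ and let $$\mathcal{Z}=\left\{s\in\mathbb{C}\mid CX_{\mathrm{op}}(sI-A^{\mathsf T})^{-1}Y_{\mathrm{op}}B=0\right\}.$$ Then the Hessian of $J_n$ at $\mathsf K^\star$ is indefinite if and only if $\operatorname{eig}(-\Lambda)\nsubseteq\mathcal{Z}$, and the Hessian of $J_n$ at $\mathsf K^\star$ is zero if and only if $\operatorname{eig}(-\Lambda)\subseteq\mathcal{Z}$.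
   Context: Fix integers $n,m,p\ge 1$, real matrices $A\in\mathbb{R}^{n\times n}$, $B\in\mathbb{R}^{n\times m}$, $C\in\mathbb{R}^{p\times n}$ (the plant $\dot x=Ax+Bu+w$, $y=Cx+v$, with $w,v$ white Gaussian noises of intensities $W,V$), and real symmetric matrices $W\succeq 0$ ($n\times n$), $V\succ 0$ ($p\times p$), $Q\succeq 0$ ($n\times n$), $R\succ 0$ ($m\times m$). Standing assumption: $(A,B)$ and $(A,W^{1/2})$ are controllable, and $(C,A)$ and $(Q^{1/2},A)$ are observable. A real square matrix is called stable if all its eigenvalues have negative real part. $\mathcal{V}_n$ is the linear space of matrices $\begin{bmatrix}0_{m\times p}&C_{\mathsf K}\\ B_{\mathsf K}&A_{\mathsf K}\end{bmatrix}\in\mathbb{R}^{(m+n)\times(p+n)}$ with $A_{\mathsf K}\in\mathbb{R}^{n\times n}$, $B_{\mathsf K}\in\mathbb{R}^{n\times p}$, $C_{\mathsf K}\in\mathbb{R}^{m\times n}$, and $\mathcal{C}_n\subseteq\mathcal{V}_n$ is the (open) subset of those $\mathsf K$ for which $A_{\mathrm{cl},\mathsf K}=\begin{bmatrix}A&BC_{\mathsf K}\\ B_{\mathsf K}C&A_{\mathsf K}\end{bmatrix}$ is stable. Such a $\mathsf K$ represents the dynamical controller $\dot\xi=A_{\mathsf K}\xi+B_{\mathsf K}y$, $u=C_{\mathsf K}\xi$. $J_n:\mathcal{C}_n\to\mathbb{R}$ is the resulting LQG cost $\lim_{T\to\infty}\frac1T\mathbb{E}\int_0^T(x^{\mathsf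 T}Qx+u^{\mathsf T}Ru)\,dt$, equivalently $$J_n(\mathsf K)=\operatorname{tr}\left(\begin{bmatrix}Q&0\\ 0&C_{\mathsf K}^{\mathsf T}RC_{\mathsf K}\end{bmatrix}X_{\mathsf K}\right),\qquad A_{\mathrm{cl},\mathsf K}X_{\mathsf K}+X_{\mathsf K}A_{\mathrm{cl},\mathsf K}^{\mathsf T}+\begin{bmatrix}W&0\\ 0&B_{\mathsf K}VB_{\mathsf K}^{\mathsf T}\end{bmatrix}=0,$$ where $X_{\mathsf K}$ is the unique solution. $J_n$ is real analytic on $\mathcal{C}_n$. A stationary point is a point where the gradient of $J_n$ in $\mathcal{V}_n$ vanishes. $\operatorname{Hess}_{\mathsf K}:\mathcal{V}_n\times\mathcal{V}_n\to\mathbb{R}$ is the symmetric bilinear form of second derivatives of $J_n$ at $\mathsf K$; it is indefinite if $\operatorname{Hess}_{\mathsf K}(\Delta,\Delta)$ takes both positive and negative values. Diagonalizable means diagonalizable over $\mathbb{C}$. *)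

(* Defs.v *)
From HB Require Import structures.
From mathcomp Require Import all_boot all_order all_algebra.
From mathcomp Require Export complex.
From mathcomp Require Import all_classical all_reals all_analysis.

Set Implicit Arguments.
Unset Strict Implicit.
Unset Printing Implicit Defensive.

Import Order.TTheory GRing.Theory Num.Theory.
Import numFieldNormedType.Exports.

Local Open Scope classical_set_scope.
Local Open Scope ring_scope.

(* The scalar field is called F, because R is the control weight. *)

Definition cplx_mx (F : realType) (m n : nat) (M : 'M[F]_(m, n)) :
    'M[F[i]]_(m, n) :=
  map_mx (real_complex F) M.

Definition eig (F : realType) (n : nat) (M : 'M[F]_n) : set F[i] :=
  [set s | eigenvalue (cplx_mx M) s].

Definition stable (F : realType) (n : nat) (M : 'M[F]_n) : Prop :=
  forall s : F[i], eig M s -> complex.Re s < 0.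

Definition psd (F : realType) (n : nat) (M : 'M[F]_n) : Prop :=
  M^T = M /\ forall x : 'cV[F]_n, 0 <= (x^T *m M *m x) 0 0.

Definition posdef (F : realType) (n : nat) (M : 'M[F]_n) : Prop :=
  M^T = M /\ forall x : 'cV[F]_n, x != 0 -> 0 < (x^T *m M *m x) 0 0.

(* M^{1/2}: every positive semidefinite M has exactly one such square root;
   the value 0 is a default for other M. *)
Definition psd_sqrt (F : realType) (n : nat) (M : 'M[F]_n) : 'M[F]_n :=
  xget 0 [set S | psd S /\ S *m S = M].

(* Any state can be steered to any other one in any positive time along
   x' = A x + B u.  For these systems it does not matter which class of inputs
   is allowed, as long as it contains the continuous ones. *)
Definition controllable (F : realType) (n m : nat)
    (A : 'M[F]_n) (B : 'M[F]_(n, m)) : Prop :=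
  forall (T : F) (x0 x1 : 'cV[F]_n), 0 < T ->
  exists (u : F -> 'cV[F]_m) (x : F -> 'cV[F]_n),
    [/\ continuous u, x 0 = x0, x T = x1 &
        forall t : F, is_derive t 1 x (A *m x t + B *m u t)].

(* The initial state of x' = A x is determined by the output C x over any time
   interval [0, T], T > 0. *)
Definition observable (F : realType) (n p : nat)
    (C : 'M[F]_(p, n)) (A : 'M[F]_n) : Prop :=
  forall (T : F) (x z : F -> 'cV[F]_n), 0 < T ->
    (forall t : F, is_derive t 1 x (A *m x t)) ->
    (forall t : F, is_derive t 1 z (A *m z t)) ->
    (forall t : F, 0 <= t <= T -> C *m x t = C *m z t) ->
  x 0 = z 0.

(* The solution X of M X + X M^T + S = 0, which is unique when M is stable;
   0 when there is no solution. *)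
Definition lyap_sol (F : realType) (n : nat) (M S : 'M[F]_n) : 'M[F]_n :=
  xget 0 [set X | M *m X + X *m M^T + S = 0].

Definition ctrl_space (F : realType) (n m p : nat) :
    set 'M[F]_(m + n, p + n) :=
  [set K | ulsubmx K = 0].

(* ursubmx K, dlsubmx K and drsubmx K are C_K, B_K and A_K. *)
Definition Acl (F : realType) (n m p : nat)
    (A : 'M[F]_n) (B : 'M[F]_(n, m)) (C : 'M[F]_(p, n))
    (K : 'M[F]_(m + n, p + n)) : 'M[F]_(n + n) :=
  block_mx A (B *m ursubmx K) (dlsubmx K *m C) (drsubmx K).

Definition stab_ctrl (F : realType) (n m p : nat)
    (A : 'M[F]_n) (B : 'M[F]_(n, m)) (C : 'M[F]_(p, n)) :
    set 'M[F]_(m + n, p + n) :=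
  [set K | @ctrl_space F n m p K /\ stable (Acl A B C K)].

(* J is written on all of M_(m + n, p + n), but it does not depend on the upper
   left block.  Below it is only differentiated at points of ctrl_space, in
   directions of ctrl_space. *)
Definition lqg_cost (F : realType) (n m p : nat)
    (A : 'M[F]_n) (B : 'M[F]_(n, m)) (C : 'M[F]_(p, n))
    (W : 'M[F]_n) (V : 'M[F]_p) (Q : 'M[F]_n) (R : 'M[F]_m)
    (K : 'M[F]_(m + n, p + n)) : F :=
  let CK := ursubmx K in
  let BK := dlsubmx K in
  let XK := lyap_sol (Acl A B C K) (block_mx W 0 0 (BK *m V *m BK^T)) in
  \tr (block_mx Q 0 0 (CK^T *m R *m CK) *m XK).

(* G is the gradient in ctrl_space, for the Frobenius inner product. *)
Definition is_gradient (F : realType) (n m p : nat)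
    (J : 'M[F]_(m + n, p + n) -> F) (K G : 'M[F]_(m + n, p + n)) : Prop :=
  [/\ differentiable J K, @ctrl_space F n m p G &
      forall D : 'M[F]_(m + n, p + n), @ctrl_space F n m p D ->
        'd J K D = \tr (G^T *m D)].

Definition stationary (F : realType) (n m p : nat)
    (S : set 'M[F]_(m + n, p + n)) (J : 'M[F]_(m + n, p + n) -> F)
    (K : 'M[F]_(m + n, p + n)) : Prop :=
  S K /\ @is_gradient F n m p J K 0.

Definition hess (F : realType) (k l : nat)
    (J : 'M[F]_(k, l) -> F) (K D1 D2 : 'M[F]_(k, l)) : F :=
  'D_D1 ('D_D2 J) K.

Definition hess_indefinite (F : realType) (n m p : nat)
    (J : 'M[F]_(m + n, p + n) -> F) (K : 'M[F]_(m + n, p + n)) : Prop :=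
  (exists2 D, @ctrl_space F n m p D & 0 < hess J K D D) /\
  (exists2 D, @ctrl_space F n m p D & hess J K D D < 0).

Definition hess_zero (F : realType) (n m p : nat)
    (J : 'M[F]_(m + n, p + n) -> F) (K : 'M[F]_(m + n, p + n)) : Prop :=
  forall D1 D2, @ctrl_space F n m p D1 -> @ctrl_space F n m p D2 ->
    hess J K D1 D2 = 0.

(* invmx M is M itself when M is singular, so the points s at which the
   resolvent does not exist have to be excluded by hand. *)
Definition Zset (F : realType) (n m p : nat)
    (A : 'M[F]_n) (B : 'M[F]_(n, m)) (C : 'M[F]_(p, n))
    (Xop Yop : 'M[F]_n) : set F[i] :=
  [set s | s%:M - cplx_mx A^T \in unitmx /\
     cplx_mx (C *m Xop) *m invmx (s%:M - cplx_mx A^T) *m cplx_mx (Yop *m B) = 0].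

(* Main.v *)
(* Write X for the closed-loop covariance and Y = Yop. Eliminating Q by the
   Lyapunov equation of Y gives, near K*,
     J(K) = tr(Y W) + tr(C_K G(K)),  G(K) = 2 X_21 Y B + X_22 C_K^T R.
   Both C_K and G vanish at K*, so K* is stationary, and the Hessian is
     tr(C_1 dG(D_2)) + tr(C_2 dG(D_1)),  dG(D) = 2 Z Y B,
   where Z depends on the B_K-component of D only:
     Lambda Z + Z A^T + B_D C Xop = 0.
   If dG(D) <> 0 for some D, replacing the C_K-component of D by dG(D)^T or by
   - dG(D)^T yields both signs; otherwise the Hessian is zero. For a left
   eigenvector v of Lambda with eigenvalue - s,
     v Z Y B = v B_D (C Xop (s I - A^T)^-1 Y B),
   and these eigenvectors span when Lambda is diagonalizable. *)

Require Import Defs.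
From HB Require Import structures.
From mathcomp Require Import all_boot all_order all_algebra.
From mathcomp Require Import all_classical all_reals all_analysis.

Set Implicit Arguments.
Unset Strict Implicit.
Unset Printing Implicit Defensive.

Import Order.TTheory GRing.Theory Num.Theory.
Import numFieldNormedType.Exports.

Local Open Scope classical_set_scope.
Local Open Scope ring_scope.

(** * Sylvester and Lyapunov equations *)

Lemma unitmx_sub_eigenvalue (k : fieldType) n (A : 'M[k]_n) (s : k) :
  ~~ eigenvalue A s -> A - s%:M \in unitmx.
Proof. by rewrite negbK -row_free_unit kermx_eq0. Qed.

Lemma horner_mx_comm (k : comNzRingType) n m (A : 'M[k]_n.+1) (N : 'M[k]_m.+1)
    (X : 'M[k]_(n.+1, m.+1)) (q : {poly k}) :
  A *m X = X *m N -> horner_mx A q *m X = X *m horner_mx N q.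
Proof.
move=> AX; elim/poly_ind: q => [|q c IH]; first by rewrite !rmorph0 mul0mx mulmx0.
rewrite !rmorphD !rmorphM /= !horner_mx_X !horner_mx_C mulmxDl mulmxDr.
by rewrite -!mulmxE -mulmxA AX mulmxA IH -mulmxA mul_scalar_mx mul_mx_scalar.
Qed.

(* The characteristic polynomial of [A] kills [A], hence also
   [X *m p (- N)], and [p (- N)] is invertible. *)
Lemma sylvester_inj (k : closedFieldType) n m (A : 'M[k]_n) (N : 'M[k]_m)
    (X : 'M[k]_(n, m)) :
  (forall s, eigenvalue A s -> ~~ eigenvalue N (- s)) ->
  A *m X + X *m N = 0 -> X = 0.
Proof.
case: n A X => [|n] A X; first by move=> *; exact: flatmx0.
case: m N X => [|m] N X; first by move=> *; exact: thinmx0.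
move=> AN /eqP; rewrite addr_eq0 -mulmxN => /eqP AX.
have [rs prs] := closed_field_poly_normal (char_poly A).
move: prs; rewrite (monicP (char_poly_monic A)) scale1r => prs.
have : X *m horner_mx (- N) (char_poly A) = 0.
  by rewrite -(horner_mx_comm _ AX) Cayley_Hamilton mul0mx.
have pN : horner_mx (- N) (char_poly A) \in unitmx.
  (* Up to sign, each factor of [p (- N)] is [N + z%:M] for an eigenvalue [z] of [A], and [- z] is
     not an eigenvalue of [N]. *)
  rewrite {1}prs rmorph_prod /= big_seq; apply: (big_ind (fun M => M \in unitmx)).
  - exact: unitmx1.
  - by move=> M M' Mu M'u; rewrite unitmx_mul Mu.
  - move=> z zrs; rewrite rmorphB /= horner_mx_X horner_mx_C -opprD.
    have Az : eigenvalue A z.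
      by rewrite eigenvalue_root_char prs root_prod_XsubC.
    have := unitmx_sub_eigenvalue (AN z Az).
    by rewrite raddfN /= opprK -[- (_ + _)]scaleN1r unitmxZ // unitrN1.
by move/(congr1 (mulmx^~ (invmx (horner_mx (- N) (char_poly A))))); rewrite mulmxK // mul0mx.
Qed.

Lemma char_poly_tr (k : comNzRingType) n (A : 'M[k]_n) :
  char_poly A^T = char_poly A.
Proof.
by rewrite /char_poly -det_tr /char_poly_mx linearB /= tr_scalar_mx map_trmx trmxK.
Qed.

Lemma stable_tr (F : realType) n (A : 'M[F]_n) : stable A -> stable A^T.
Proof.
move=> sA s; rewrite /eig /= /cplx_mx -map_trmx => es; apply: sA.
by move: es; rewrite /eig /= !eigenvalue_root_char char_poly_tr.
Qed.

(** Over the complex numbers, the negative of an eigenvalue of [A] has positive real part, so it is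
    not an eigenvalue of [N] and [sylvester_inj] applies. *)
Lemma stable_sylvester_inj (F : realType) n m (A : 'M[F]_n) (N : 'M[F]_m)
    (X : 'M[F]_(n, m)) :
  stable A -> stable N -> A *m X + X *m N = 0 -> X = 0.
Proof.
move=> sA sN AX; apply/eqP; rewrite -(map_mx_eq0 (real_complex F)); apply/eqP.
apply: (@sylvester_inj _ _ _ (cplx_mx A) (cplx_mx N)).
  move=> s /sA s0; apply/negP => /sN; rewrite raddfN /= oppr_lt0 => s1.
  by have := lt_trans s0 s1; rewrite ltxx.
by rewrite -!map_mxM -map_mxD AX map_mx0.
Qed.

(** At least one half of a left eigenvector is nonzero, and that half is an eigenvector of its
    diagonal block. *)
Lemma stable_block_diag (F : realType) n m (A : 'M[F]_n) (D : 'M[F]_m) :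
  stable A -> stable D -> stable (block_mx A 0 0 D).
Proof.
move=> sA sD s /eigenvalueP[v + v0].
rewrite /cplx_mx map_block_mx !map_mx0 -{1}[v]hsubmxK mul_row_block !mulmx0.
rewrite addr0 add0r -{3}[v]hsubmxK scale_row_mx => /eq_row_mx[eA eD].
have [v10|v10] := eqVneq (lsubmx v) 0; last first.
  by apply: sA; apply/eigenvalueP; exists (lsubmx v).
apply: sD; apply/eigenvalueP; exists (rsubmx v) => //.
apply: contraNneq v0 => v20; by rewrite -[v]hsubmxK v10 v20 row_mx0.
Qed.

(** * Sylvester equations as vectorized linear systems *)

Section Sylvester.
Variables (F : realType) (n : nat).
Implicit Types M N S X : 'M[F]_n.

(** The operator sending [X] to [M *m X + X *m N], acting on vectorized matrices. Its entries are
    linear in [M] and [N], which gives a solution formula that can be differentiated in the data. *)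
Definition syl_mx M N : 'M[F]_(n * n) := lin_mulmx M + lin_mulmxr N.

Definition syl_sol M N S : 'M[F]_n :=
  vec_mx (- mxvec S *m invmx (syl_mx M N)).

Lemma mul_mxvec_syl_mx M N X : mxvec X *m syl_mx M N = mxvec (M *m X + X *m N).
Proof. by rewrite mulmxDr !mul_vec_lin -linearD. Qed.

Lemma syl_mx_unit M N : stable M -> stable N -> syl_mx M N \in unitmx.
Proof.
move=> sM sN; rewrite -row_free_unit; apply: inj_row_free => v.
move=> vM; rewrite -[v]vec_mxK.
suff /(stable_sylvester_inj sM sN) -> : M *m vec_mx v + vec_mx v *m N = 0.
  by rewrite linear0.
by apply: (can_inj mxvecK); rewrite -mul_mxvec_syl_mx vec_mxK vM linear0.
Qed.

Lemma syl_solP M N S X : syl_mx M N \in unitmx ->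
  M *m X + X *m N + S = 0 <-> X = syl_sol M N S.
Proof.
move=> u; split=> [/eqP|->].
  rewrite addr_eq0 => /eqP/(congr1 mxvec); rewrite -mul_mxvec_syl_mx linearN => h.
  by rewrite /syl_sol -h mulmxK // mxvecK.
apply: (can_inj mxvecK); rewrite linearD /= -mul_mxvec_syl_mx vec_mxK mulmxKV //.
by rewrite addNr linear0.
Qed.

(** Trades the chosen solution in the cost for an explicit formula. *)
Lemma lyap_solE M S : syl_mx M M^T \in unitmx ->
  lyap_sol M S = syl_sol M M^T S.
Proof.
move=> u; rewrite /lyap_sol; apply: xget_unique => /=.
  by apply/(syl_solP _ _ u).
by move=> Y /(syl_solP _ _ u).
Qed.

(** The transpose solves the same equation, so uniqueness applies. *)
Lemma syl_sol_tr M S : syl_mx M M^T \in unitmx -> S^T = S ->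
  (syl_sol M M^T S)^T = syl_sol M M^T S.
Proof.
move=> u SS; apply/(syl_solP _ _ u).
have /(syl_solP _ _ u) /(congr1 trmx) := erefl (syl_sol M M^T S).
by rewrite !linearD /= !trmx_mul trmxK SS trmx0 [X in X + _]addrC.
Qed.

End Sylvester.

(** * Functions of class C1 at a point *)

Lemma near_eq_differentiable (F : numFieldType) (V W : normedModType F)
    (f g : V -> W) (x : V) :
  (\near x, f x = g x) -> differentiable f x -> differentiable g x.
Proof.
move=> fg df.
have dfc : continuous ('d f x) by exact: diff_continuous.
(* The differential of [f] also serves for [g], since the error terms agree near the point. *)
have dg : g \o shift x = cst (g x) + 'd f x +o_ 0 id.
  apply/eqaddoP => e e0.
  have := diff_locally df; move/eqaddoP/(_ e e0) => H.
  have fg0 : \forall h \near 0, f (h + x) = g (h + x).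
    by move: fg; rewrite (near_shift 0 x); apply: filterS => h /=; rewrite subr0.
  near=> h.
  rewrite -(nbhs_singleton fg).
  rewrite -[X in `|X|]/(g (h + x) - (f x + 'd f x h)).
  have <- : f (h + x) = g (h + x) by near: h.
  by near: h; exact: H.
by apply/diff_locallyP; rewrite (diff_unique dfc dg); split.
Unshelve. all: by end_near. Qed.

Section C1.
Variables (F : realType) (V : normedModType F) (K0 : V).
Implicit Types f g : V -> F.

(** Continuity of the derivatives is asked at [K0] only; this is preserved by sums, products and
    inverses. *)
Definition C1_at f : Prop :=
  (\forall K \near K0, differentiable f K) /\
  forall D, {for K0, continuous ('D_D f)}.

Lemma C1_at_differentiable f : C1_at f -> differentiable f K0.
Proof. by case=> /nbhs_singleton. Qed.

Lemma C1_at_derivable f D : C1_at f -> derivable f K0 D.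
Proof. by move/C1_at_differentiable/diff_derivable. Qed.

Lemma C1_at_continuous f : C1_at f -> {for K0, continuous f}.
Proof. by move/C1_at_differentiable/differentiable_continuous. Qed.

Lemma near_eq_continuous_for (h h' : V -> F) :
  (\forall K \near K0, h' K = h K) ->
  {for K0, continuous h'} -> {for K0, continuous h}.
Proof.
move=> hh' ch'; rewrite /prop_for /continuous_at -(nbhs_singleton hh').
by apply: cvg_trans ch'; apply: near_eq_cvg.
Qed.

Lemma near_eq_C1_at f g : (\forall K \near K0, f K = g K) -> C1_at f -> C1_at g.
Proof.
(* Equality near [K0] is also equality near each nearby point, so the derivatives agree near [K0]
   too. *)
move=> /near_join fg [df cf]; split.
  near=> K; apply: (@near_eq_differentiable _ _ _ f g K _ _); near: K.
    exact: fg.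
  exact: df.
move=> D; apply: near_eq_continuous_for (cf D).
near=> K; apply: near_eq_derive; near: K; exact: fg.
Unshelve. all: by end_near. Qed.

Lemma C1_at_cst (a : F) : C1_at (fun=> a).
Proof.
split; first by near=> K; exact: differentiable_cst.
move=> D; have -> : 'D_D (fun=> a) = fun=> 0 :> F.
  by apply/funext => K; rewrite derive_cst.
exact: cst_continuous.
Unshelve. all: by end_near. Qed.

Lemma C1_atD f g : C1_at f -> C1_at g -> C1_at (fun K => f K + g K).
Proof.
move=> [df cf] [dg cg]; split.
  by near=> K; apply: differentiableD; near: K.
move=> D; apply: (@near_eq_continuous_for _ (fun K => 'D_D f K + 'D_D g K)).
  by near=> K; rewrite -deriveD //; apply: diff_derivable; near: K.
by apply: cvgD; [exact: cf|exact: cg].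
Unshelve. all: by end_near. Qed.

Lemma C1_atM f g : C1_at f -> C1_at g -> C1_at (fun K => f K * g K).
Proof.
move=> C1f C1g; have [df cf] := C1f; have [dg cg] := C1g; split.
  by near=> K; apply: differentiableM; near: K.
move=> D.
apply: (@near_eq_continuous_for _ (fun K => f K * 'D_D g K + g K * 'D_D f K)).
  near=> K; rewrite -[LHS]/(f K *: 'D_D g K + g K *: 'D_D f K) -deriveM //.
  - by apply: diff_derivable; near: K.
  - by apply: diff_derivable; near: K.
apply: cvgD; apply: cvgM.
- exact: C1_at_continuous.
- exact: cg.
- exact: C1_at_continuous.
- exact: cf.
Unshelve. all: by end_near. Qed.

Lemma C1_atN f : C1_at f -> C1_at (fun K => - f K).
Proof.
move=> C1f; have := C1_atM (C1_at_cst (-1)) C1f.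
by under eq_fun do rewrite mulN1r.
Qed.

Lemma C1_atV f : f K0 != 0 -> C1_at f -> C1_at (fun K => (f K)^-1).
Proof.
move=> f0 C1f; have [df cf] := C1f.
have cf0 := C1_at_continuous C1f.
have nf0 : \forall K \near K0, f K != 0.
  exact: cvgr_neq0 cf0 f0.
split.
  by near=> K; apply: differentiableV; near: K.
move=> D.
apply: (@near_eq_continuous_for _ (fun K => - ((f K)^-1 * (f K)^-1) * 'D_D f K)).
  near=> K; rewrite deriveV.
  - by rewrite -exprVn expr2.
  - by near: K.
  - by apply: diff_derivable; near: K.
have cV : {for K0, continuous (fun K => (f K)^-1)} by exact: cvgV.
exact: (cvgM (cvgN (cvgM cV cV)) (cf D)).
Unshelve. all: by end_near. Qed.

Lemma C1_at_sum (I : Type) (r : seq I) (P : pred I) (f : I -> V -> F) :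
  (forall i, P i -> C1_at (f i)) -> C1_at (fun K => \sum_(i <- r | P i) f i K).
Proof.
move=> Cf; elim: r => [|i r IH].
  by under eq_fun do rewrite big_nil; exact: C1_at_cst.
under eq_fun do rewrite big_cons.
by case Pi: (P i); [apply: C1_atD; [exact: Cf|exact: IH]|exact: IH].
Qed.

Lemma C1_at_prod (I : Type) (r : seq I) (P : pred I) (f : I -> V -> F) :
  (forall i, P i -> C1_at (f i)) -> C1_at (fun K => \prod_(i <- r | P i) f i K).
Proof.
move=> Cf; elim: r => [|i r IH].
  by under eq_fun do rewrite big_nil; exact: C1_at_cst.
under eq_fun do rewrite big_cons.
by case Pi: (P i); [apply: C1_atM; [exact: Cf|exact: IH]|exact: IH].
Qed.

(** * Matrix functions of class C1 *)

Definition C1_mx a b (M : V -> 'M[F]_(a, b)) : Prop :=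
  forall i j, C1_at (fun K => M K i j).

Lemma C1_mx_cst a b (M : 'M[F]_(a, b)) : C1_mx (fun=> M).
Proof. by move=> i j; exact: C1_at_cst. Qed.

Lemma C1_mxD a b (M N : V -> 'M[F]_(a, b)) :
  C1_mx M -> C1_mx N -> C1_mx (fun K => M K + N K).
Proof. by move=> cM cN i j; under eq_fun do rewrite mxE; exact: C1_atD. Qed.

Lemma C1_mxN a b (M : V -> 'M[F]_(a, b)) :
  C1_mx M -> C1_mx (fun K => - M K).
Proof. by move=> cM i j; under eq_fun do rewrite mxE; exact: C1_atN. Qed.

Lemma C1_mxZ a b (f : V -> F) (M : V -> 'M[F]_(a, b)) :
  C1_at f -> C1_mx M -> C1_mx (fun K => f K *: M K).
Proof. move=> cf cM i j; under eq_fun do rewrite mxE; exact: (C1_atM cf (cM i j)). Qed.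

Lemma C1_mxM a b c (M : V -> 'M[F]_(a, b)) (N : V -> 'M[F]_(b, c)) :
  C1_mx M -> C1_mx N -> C1_mx (fun K => M K *m N K).
Proof.
move=> cM cN i j; under eq_fun do rewrite mxE.
by apply: C1_at_sum => k _; exact: C1_atM.
Qed.

Lemma C1_mx_tr a b (M : V -> 'M[F]_(a, b)) :
  C1_mx M -> C1_mx (fun K => (M K)^T).
Proof. by move=> cM i j; under eq_fun do rewrite mxE. Qed.

Lemma C1_mx_block a b c d (Mul : V -> 'M[F]_(a, b)) (Mur : V -> 'M[F]_(a, c))
    (Mdl : V -> 'M[F]_(d, b)) (Mdr : V -> 'M[F]_(d, c)) :
  C1_mx Mul -> C1_mx Mur -> C1_mx Mdl -> C1_mx Mdr ->
  C1_mx (fun K => block_mx (Mul K) (Mur K) (Mdl K) (Mdr K)).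
Proof.
move=> cul cur cdl cdr i j.
case: (split_ordP i) => i' ->; case: (split_ordP j) => j' ->.
- by under eq_fun do rewrite block_mxEul.
- by under eq_fun do rewrite block_mxEur.
- by under eq_fun do rewrite block_mxEdl.
- by under eq_fun do rewrite block_mxEdr.
Qed.

Lemma C1_det a (M : V -> 'M[F]_a) : C1_mx M -> C1_at (fun K => \det (M K)).
Proof.
move=> cM; apply: C1_at_sum => s _; apply: C1_atM; first exact: C1_at_cst.
by apply: C1_at_prod => i _.
Qed.

Lemma C1_mx_adj a (M : V -> 'M[F]_a) : C1_mx M -> C1_mx (fun K => \adj (M K)).
Proof.
move=> cM i j; under eq_fun do rewrite mxE.
apply: C1_atM; first exact: C1_at_cst.
by apply: C1_det => k l; under eq_fun do rewrite !mxE.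
Qed.

Lemma C1_mx_mxvec a b (M : V -> 'M[F]_(a, b)) :
  C1_mx M -> C1_mx (fun K => mxvec (M K)).
Proof.
move=> cM i k; rewrite ord1; case/mxvec_indexP: k => k l.
by under eq_fun do rewrite mxvecE.
Qed.

Lemma C1_mx_vec_mx a b (M : V -> 'rV[F]_(a * b)) :
  C1_mx M -> C1_mx (fun K => vec_mx (M K)).
Proof. by move=> cM i k; under eq_fun do rewrite mxE. Qed.

Lemma near_eq_C1_mx a b (M N : V -> 'M[F]_(a, b)) :
  (\forall K \near K0, M K = N K) -> C1_mx M -> C1_mx N.
Proof.
move=> MN cM i j; apply: near_eq_C1_at (cM i j).
by apply: filterS MN => K ->.
Qed.

Lemma near_unitmx a (M : V -> 'M[F]_a) : C1_mx M -> M K0 \in unitmx ->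
  \forall K \near K0, M K \in unitmx.
Proof.
move=> cM; rewrite unitmxE unitfE => M0.
have cdet := C1_at_continuous (C1_det cM).
have : \forall K \near K0, \det (M K) != 0 by exact: cvgr_neq0 cdet M0.
by apply: filterS => K; rewrite unitmxE unitfE.
Qed.

(** Near [K0] the determinant stays nonzero, and Cramer's rule writes the inverse through
    determinants. *)
Lemma C1_mx_inv a (M : V -> 'M[F]_a) : C1_mx M -> M K0 \in unitmx ->
  C1_mx (fun K => invmx (M K)).
Proof.
move=> cM M0.
apply: (@near_eq_C1_mx _ _ (fun K => (\det (M K))^-1 *: \adj (M K))).
  by apply: filterS (near_unitmx cM M0) => K MK; rewrite /invmx MK.
apply: C1_mxZ; last exact: C1_mx_adj.
by apply: C1_atV; [move: M0; rewrite unitmxE unitfE|exact: C1_det].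
Qed.

Lemma C1_mxtrace a (M : V -> 'M[F]_a) : C1_mx M -> C1_at (fun K => \tr (M K)).
Proof. by move=> cM; exact: C1_at_sum. Qed.

(** * Directional derivatives of matrix functions *)

Definition dmx (D : V) a b (M : V -> 'M[F]_(a, b)) : 'M[F]_(a, b) :=
  \matrix_(i, j) 'D_D (fun K => M K i j) K0.

Lemma near_eq_dmx D a b (M N : V -> 'M[F]_(a, b)) :
  (\forall K \near K0, M K = N K) -> dmx D M = dmx D N.
Proof.
move=> MN; apply/matrixP => i j; rewrite !mxE; apply: near_eq_derive.
by apply: filterS MN => K ->.
Qed.

Lemma dmx_cst D a b (M : 'M[F]_(a, b)) : dmx D (fun=> M) = 0.
Proof. by apply/matrixP => i j; rewrite !mxE derive_cst. Qed.

Lemma dmxD D a b (M N : V -> 'M[F]_(a, b)) : C1_mx M -> C1_mx N ->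
  dmx D (fun K => M K + N K) = dmx D M + dmx D N.
Proof.
move=> cM cN; apply/matrixP => i j; rewrite !mxE.
under eq_fun do rewrite mxE.
by rewrite -deriveD //; exact: C1_at_derivable.
Qed.

Lemma derive_sum_C1 D (I : Type) (r : seq I) (f : I -> V -> F) :
  (forall i, C1_at (f i)) ->
  'D_D (fun K => \sum_(i <- r) f i K) K0 = \sum_(i <- r) 'D_D (f i) K0.
Proof.
move=> Cf; elim: r => [|i r IH].
  by under eq_fun do rewrite big_nil; rewrite derive_cst big_nil.
under eq_fun do rewrite big_cons.
rewrite big_cons -IH -deriveD //; first exact: C1_at_derivable.
by apply: C1_at_derivable; exact: C1_at_sum.
Qed.

Lemma derive_mxtrace D a (M : V -> 'M[F]_a) :
  C1_mx M -> 'D_D (fun K => \tr (M K)) K0 = \tr (dmx D M).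
Proof.
move=> cM; rewrite /mxtrace derive_sum_C1 //.
by apply: eq_bigr => i _; rewrite mxE.
Qed.

Lemma dmxM D a b c (M : V -> 'M[F]_(a, b)) (N : V -> 'M[F]_(b, c)) :
  C1_mx M -> C1_mx N ->
  dmx D (fun K => M K *m N K) = dmx D M *m N K0 + M K0 *m dmx D N.
Proof.
move=> cM cN; apply/matrixP => i j; rewrite !mxE.
under eq_fun do rewrite mxE.
rewrite derive_sum_C1; last by move=> k; exact: C1_atM.
rewrite -big_split /=; apply: eq_bigr => k _; rewrite !mxE.
rewrite (deriveM (C1_at_derivable (cM i k)) (C1_at_derivable (cN k j))).
by rewrite /GRing.scale /= addrC; congr (_ + _); exact: mulrC.
Qed.

Lemma is_derive_mul0 (u v : V -> F) D : derivable u K0 D -> u K0 = 0 ->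
  {for K0, continuous v} ->
  is_derive K0 D (fun K => u K * v K) ('D_D u K0 * v K0).
Proof.
move=> du u0 cv.
have line : h *: D + K0 @[h --> (0 : F)^'] --> K0.
  rewrite -[X in _ --> X]add0r -[X in _ --> X + _](scale0r D).
  apply: cvgD; last exact: cvg_cst.
  by apply: cvgZr_tmp; exact: nbhs_dnbhs.
have c : h^-1 *: (u (h *: D + K0) * v (h *: D + K0) - u K0 * v K0)
    @[h --> 0^'] --> 'D_D u K0 * v K0.
  (* As [u K0 = 0], the difference quotient of the product is that of [u] times a nearby value of
     [v], so continuity of [v] is enough. *)
  under eq_fun => h do rewrite u0 mul0r subr0 scalerAl -[u (_ + _)]subr0 -u0.
  by apply: cvgM; [exact: du|exact: (cvg_comp _ _ line cv)].
by apply: DeriveDef; [apply: cvgP c|apply: cvg_lim c].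
Qed.

(* Only first derivatives enter the second derivative of a product of functions
   vanishing at [K0], so [C1_at] suffices. *)
Lemma is_derive2_mul f g D1 D2 : C1_at f -> C1_at g -> f K0 = 0 -> g K0 = 0 ->
  is_derive K0 D1 ('D_D2 (fun K => f K * g K))
    ('D_D1 f K0 * 'D_D2 g K0 + 'D_D1 g K0 * 'D_D2 f K0).
Proof.
move=> C1f C1g f0 g0; have [df cf] := C1f; have [dg cg] := C1g.
have H : \forall K \near K0, f K * 'D_D2 g K + g K * 'D_D2 f K =
    'D_D2 (fun K => f K * g K) K.
  near=> K; rewrite -[LHS]/(f K *: 'D_D2 g K + g K *: 'D_D2 f K) -deriveM.
  - by [].
  - by apply: diff_derivable; near: K.
  - by apply: diff_derivable; near: K.
apply: (near_eq_is_derive H).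
apply: is_deriveD.
- exact: is_derive_mul0 (C1_at_derivable C1f) f0 (cg D2).
- exact: is_derive_mul0 (C1_at_derivable C1g) g0 (cf D2).
Unshelve. all: by end_near. Qed.

(** Regularity travels with the value, because adding second derivatives requires first derivatives
    to add up at all points near [K0]. *)
Definition derive2_at f D1 D2 (q : F) : Prop :=
  C1_at f /\ is_derive K0 D1 ('D_D2 f) q.

Lemma derive2_at_cst a D1 D2 : derive2_at (fun=> a) D1 D2 0.
Proof.
split; first exact: C1_at_cst.
have -> : 'D_D2 (fun=> a) = cst (0 : F).
  by apply/funext => K; rewrite derive_cst.
exact: is_derive_cst.
Qed.

Lemma derive2_atD f g D1 D2 q r : derive2_at f D1 D2 q -> derive2_at g D1 D2 r ->
  derive2_at (fun K => f K + g K) D1 D2 (q + r).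
Proof.
move=> [C1f dq] [C1g dr]; split; first exact: C1_atD.
have [df _] := C1f; have [dg _] := C1g.
have H : \forall K \near K0, 'D_D2 f K + 'D_D2 g K =
    'D_D2 (fun K => f K + g K) K.
  near=> K; rewrite -deriveD.
  - by [].
  - by apply: diff_derivable; near: K.
  - by apply: diff_derivable; near: K.
by apply: (near_eq_is_derive H); exact: is_deriveD.
Unshelve. all: by end_near. Qed.

Lemma derive2_at_sum (I : Type) (r : seq I) (f : I -> V -> F) D1 D2 q :
  (forall i, derive2_at (f i) D1 D2 (q i)) ->
  derive2_at (fun K => \sum_(i <- r) f i K) D1 D2 (\sum_(i <- r) q i).
Proof.
move=> H; elim: r => [|i r IH].
  by under eq_fun do rewrite big_nil; rewrite big_nil; exact: derive2_at_cst.
under eq_fun do rewrite big_cons.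
by rewrite big_cons; exact: derive2_atD (H i) IH.
Qed.

Lemma derive2_at_mxtrace a b (M : V -> 'M[F]_(a, b)) (N : V -> 'M[F]_(b, a))
    D1 D2 :
  C1_mx M -> C1_mx N -> M K0 = 0 -> N K0 = 0 ->
  derive2_at (fun K => \tr (M K *m N K)) D1 D2
    (\tr (dmx D1 M *m dmx D2 N) + \tr (dmx D2 M *m dmx D1 N)).
Proof.
move=> cM cN M0 N0.
under eq_fun do rewrite /mxtrace.
rewrite -big_split /=; apply: derive2_at_sum => i.
under eq_fun do rewrite mxE.
rewrite !mxE -big_split /=; apply: derive2_at_sum => k.
split; first exact: C1_atM.
rewrite !mxE [X in is_derive _ _ _ (_ + X)]mulrC.
by apply: is_derive2_mul; rewrite ?M0 ?N0 ?mxE.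
Qed.

Lemma near_eq_derive2_at f g D1 D2 q :
  (\forall K \near K0, f K = g K) -> derive2_at f D1 D2 q ->
  derive2_at g D1 D2 q.
Proof.
move=> fg [C1f dq]; split; first exact: near_eq_C1_at C1f.
apply: near_eq_is_derive dq.
have H := near_join fg.
near=> K; apply: near_eq_derive; near: K; exact: H.
Unshelve. all: by end_near. Qed.

End C1.

Lemma is_derive_coord (F : realType) a b (K D : 'M[F]_(a, b)) i j :
  is_derive K D (fun K : 'M[F]_(a, b) => K i j) (D i j).
Proof.
have c : h^-1 *: ((h *: D + K) i j - K i j) @[h --> (0 : F)^'] --> D i j.
  have Dij : D i j @[h --> (0 : F)^'] --> D i j by exact: cvg_cst.
  apply: cvg_trans Dij; apply: near_eq_cvg; near=> h.
  rewrite !mxE addrK /GRing.scale /= mulKf //.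
  by near: h; exact: nbhs_dnbhs_neq.
by apply: DeriveDef; [apply: cvgP c|apply: cvg_lim c].
Unshelve. all: by end_near. Qed.

Lemma C1_mx_id (F : realType) a b (K0 : 'M[F]_(a, b)) : C1_mx K0 id.
Proof.
move=> i j; split; first by near=> K; exact: differentiable_coord.
move=> D; have -> : 'D_D (fun K : 'M[F]_(a, b) => K i j) = fun=> D i j.
  by apply/funext => K; have [_ ->] := is_derive_coord K D i j.
exact: cst_continuous.
Unshelve. all: by end_near. Qed.

Lemma dmx_id (F : realType) a b (K0 D : 'M[F]_(a, b)) : dmx K0 D id = D.
Proof.
apply/matrixP => i j; rewrite mxE.
by have [_ ->] := is_derive_coord K0 D i j.
Qed.

(** * The cost near the open-loop controller *)

Section Submatrices.
Variables (F : realType) (V : normedModType F) (K0 D : V) (a b c d : nat).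
Variable M : V -> 'M[F]_(a + b, c + d).

Lemma C1_mx_submx : C1_mx K0 M ->
  [/\ C1_mx K0 (fun K => ulsubmx (M K)), C1_mx K0 (fun K => ursubmx (M K)),
      C1_mx K0 (fun K => dlsubmx (M K)) & C1_mx K0 (fun K => drsubmx (M K))].
Proof. by move=> cM; split=> i j; under eq_fun do rewrite !mxE. Qed.

Lemma dmx_ursubmx : dmx K0 D (fun K => ursubmx (M K)) = ursubmx (dmx K0 D M).
Proof.
by apply/matrixP => i j; rewrite !mxE; under eq_fun do rewrite !mxE.
Qed.

Lemma dmx_dlsubmx : dmx K0 D (fun K => dlsubmx (M K)) = dlsubmx (dmx K0 D M).
Proof.
by apply/matrixP => i j; rewrite !mxE; under eq_fun do rewrite !mxE.
Qed.

End Submatrices.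

Lemma C1_syl_sol (F : realType) (V : normedModType F) (K0 : V) n
    (M N S : V -> 'M[F]_n) :
  C1_mx K0 M -> C1_mx K0 N -> C1_mx K0 S -> syl_mx (M K0) (N K0) \in unitmx ->
  C1_mx K0 (fun K => syl_mx (M K) (N K)) /\
  C1_mx K0 (fun K => syl_sol (M K) (N K) (S K)).
Proof.
move=> cM cN cS u.
have csyl : C1_mx K0 (fun K => syl_mx (M K) (N K)).
  apply: C1_mxD.
    (* Each row of the operator matrix is the vectorized image of a basis matrix. *)
    move=> i j; under eq_fun do rewrite !mxE /=.
    apply: C1_mx_mxvec.
    by apply: C1_mxM => //; exact: C1_mx_cst.
  move=> i j; under eq_fun do rewrite !mxE /=.
  apply: C1_mx_mxvec.
  by apply: C1_mxM => //; exact: C1_mx_cst.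
split=> //; apply: C1_mx_vec_mx; apply: C1_mxM; last exact: C1_mx_inv.
by apply: C1_mxN; exact: C1_mx_mxvec.
Qed.

(** * Eliminating the state weight from the cost *)

Section CostSplit.
Variables (F : realType) (n m p : nat).
Variables (A : 'M[F]_n) (B : 'M[F]_(n, m)) (C : 'M[F]_(p, n)).
Variables (W Q Y : 'M[F]_n) (R : 'M[F]_m).
Variables (CK : 'M[F]_(m, n)) (BK : 'M[F]_(n, p)) (AK S : 'M[F]_n).
Variable X : 'M[F]_(n + n).
Let M := block_mx A (B *m CK) (BK *m C) AK.
Hypothesis eqX : M *m X + X *m M^T + block_mx W 0 0 S = 0.

(** The upper left block serves to eliminate [Q]; the lower left one, once differentiated,
    determines the variation of the cross covariance. *)
Lemma lyap_blocks :
  A *m ulsubmx X + B *m CK *m dlsubmx X + (ulsubmx X *m A^T +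
    ursubmx X *m (B *m CK)^T) + W = 0 /\
  BK *m C *m ulsubmx X + AK *m dlsubmx X + (dlsubmx X *m A^T +
    drsubmx X *m (B *m CK)^T) = 0.
Proof.
move: eqX; rewrite -[X in M *m X]submxK -[X in X *m M^T]submxK tr_block_mx.
rewrite !mulmx_block !add_block_mx => /eqP; rewrite block_mx_eq0 !addr0.
by case/and4P=> /eqP -> _ /eqP -> _.
Qed.

(** Lyapunov duality: the equation of [Y] turns the trace of [Q *m ulsubmx X] into minus that of [Y]
    times [A *m ulsubmx X + ulsubmx X *m A^T], and the upper left block replaces this sum by [W] and
    two cross terms. Transposition shows that the cross terms have equal traces, whence the factor
    2. *)
Lemma cost_split : X^T = X -> Y^T = Y -> A^T *m Y + Y *m A + Q = 0 ->
  \tr (block_mx Q 0 0 (CK^T *m R *m CK) *m X) =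
  \tr (Y *m W) +
  \tr (CK *m (dlsubmx X *m (Y *m B *+ 2) + drsubmx X *m CK^T *m R)).
Proof.
move=> symX symY /eqP; rewrite addrC addr_eq0 => /eqP eqQ.
have [eqX11 _] := lyap_blocks.
have symur : (ursubmx X)^T = dlsubmx X by rewrite trmx_ursub symX.
rewrite -{1}[X]submxK mulmx_block !mul0mx !addr0 !add0r mxtrace_block.
rewrite [in RHS]mulmxDr [in RHS]mxtraceD addrA; congr (_ + _); last first.
  by rewrite -!mulmxA mxtrace_mulC -!mulmxA mxtrace_mulC -!mulmxA.
rewrite eqQ mulNmx mulmxDl linearN /= linearD /=.
have -> : \tr (A^T *m Y *m ulsubmx X) = \tr (Y *m (ulsubmx X *m A^T)).
  by rewrite -mulmxA mxtrace_mulC mulmxA.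
rewrite -[Y *m A *m _]mulmxA -linearD /= -mulmxDr.
have -> : ulsubmx X *m A^T + A *m ulsubmx X =
    - (W + B *m CK *m dlsubmx X + ursubmx X *m (B *m CK)^T).
  apply/eqP; rewrite -addr_eq0 -[X in _ == X]eqX11; apply/eqP.
  by rewrite !addrA [LHS](ACl (2*4*1*5*3)).
rewrite mulmxN linearN /= opprK !mulmxDr !linearD /= -addrA; congr (_ + _).
congr (_ + _).
  by rewrite -!mulmxA mxtrace_mulC -!mulmxA mxtrace_mulC -!mulmxA.
rewrite -mxtrace_tr !trmx_mul !trmxK symur symY.
by rewrite -!mulmxA mxtrace_mulC -!mulmxA.
Qed.

End CostSplit.

(** * Derivatives at the open-loop controller *)

Section OpenLoop.
Variables (F : realType) (n m p : nat).
Variables (A : 'M[F]_n) (B : 'M[F]_(n, m)) (C : 'M[F]_(p, n)).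
Variables (W : 'M[F]_n) (V : 'M[F]_p) (Q : 'M[F]_n) (R : 'M[F]_m).
Variable Lambda : 'M[F]_n.
Hypotheses (symW : W^T = W) (symV : V^T = V) (symQ : Q^T = Q).
Hypotheses (A_stable : stable A) (Lambda_stable : stable Lambda).

Notation ctrl := 'M[F]_(m + n, p + n).
Let Kstar : ctrl := block_mx 0 0 0 Lambda.
Let J := @lqg_cost F n m p A B C W V Q R.
Let M (K : ctrl) : 'M[F]_(n + n) := Acl A B C K.
Let S (K : ctrl) : 'M[F]_(n + n) :=
  block_mx W 0 0 (dlsubmx K *m V *m (dlsubmx K)^T).
(** A formula instead of [lyap_sol], so that [C1_syl_sol] yields its smoothness; the two agree near
    [Kstar]. *)
Let X (K : ctrl) : 'M[F]_(n + n) := syl_sol (M K) (M K)^T (S K).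
Let Xop : 'M[F]_n := syl_sol A A^T W.
Let Yop : 'M[F]_n := syl_sol A^T A Q.
Let G (K : ctrl) : 'M[F]_(n, m) :=
  dlsubmx (X K) *m (Yop *m B *+ 2) + drsubmx (X K) *m (ursubmx K)^T *m R.

Let C1_K := C1_mx_submx (C1_mx_id Kstar).

Let C1_M : C1_mx Kstar M.
Proof.
have [_ cC cB cA] := C1_K.
apply: C1_mx_block.
- exact: C1_mx_cst.
- by apply: C1_mxM; [exact: C1_mx_cst|exact: cC].
- by apply: C1_mxM; [exact: cB|exact: C1_mx_cst].
- exact: cA.
Qed.

Let C1_S : C1_mx Kstar S.
Proof.
have [_ cC cB cA] := C1_K.
apply: C1_mx_block; [exact: C1_mx_cst..|].
apply: C1_mxM; last exact: C1_mx_tr.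
by apply: C1_mxM; [exact: cB|exact: C1_mx_cst].
Qed.

Let MKstar : M Kstar = block_mx A 0 0 Lambda.
Proof.
by rewrite /M /Acl /Kstar block_mxKur block_mxKdl block_mxKdr mulmx0 mul0mx.
Qed.

Lemma open_loop_stab : stab_ctrl A B C Kstar.
Proof.
split; first by rewrite /ctrl_space /= block_mxKul.
by rewrite -/(M Kstar) MKstar; exact: stable_block_diag.
Qed.

Let syl_unit : syl_mx (M Kstar) (M Kstar)^T \in unitmx.
Proof.
have [_ st] := open_loop_stab.
exact: (syl_mx_unit st (stable_tr st)).
Qed.

Let C1_X : C1_mx Kstar X.
Proof. by have [] := C1_syl_sol C1_M (C1_mx_tr C1_M) C1_S syl_unit. Qed.

Let near_syl_unit : \forall K \near Kstar, syl_mx (M K) (M K)^T \in unitmx.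
Proof.
have [H _] := C1_syl_sol C1_M (C1_mx_tr C1_M) C1_S syl_unit.
exact: near_unitmx H syl_unit.
Qed.

(** At [Kstar] the loop is decoupled and noise enters the plant only, so the controller state has
    zero covariance. *)
Let XKstar : X Kstar = block_mx Xop 0 0 0.
Proof.
apply/esym/(syl_solP _ _ syl_unit).
rewrite MKstar /S /Kstar block_mxKdl tr_block_mx !mulmx_block !trmx0.
rewrite !(mul0mx, mulmx0, addr0) !add_block_mx !addr0.
have uA := syl_mx_unit A_stable (stable_tr A_stable).
by have /(syl_solP _ _ uA) -> := erefl Xop; rewrite block_mx0.
Qed.

Let uY : syl_mx A^T A \in unitmx.
Proof. exact: (syl_mx_unit (stable_tr A_stable) A_stable). Qed.

Let symY : Yop^T = Yop.
Proof.
by have := @syl_sol_tr _ _ A^T Q; rewrite trmxK; apply.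
Qed.

Let near_J : \forall K \near Kstar,
  J K = \tr (Yop *m W) + \tr (ursubmx K *m G K).
Proof.
apply: filterS near_syl_unit => K u.
rewrite /J /lqg_cost -/(M K) -/(S K) lyap_solE //.
have eqX : M K *m X K + X K *m (M K)^T + S K = 0 by apply/(syl_solP _ _ u).
have eqY : A^T *m Yop + Yop *m A + Q = 0 by apply/(syl_solP _ _ uY).
apply: (@cost_split _ _ _ _ A B C W Q Yop R _ _ _ _ _ eqX _ symY eqY).
apply: syl_sol_tr; first exact: u.
by rewrite /S tr_block_mx !trmx0 symW !trmx_mul trmxK symV mulmxA.
Qed.

Let C1_G : C1_mx Kstar G.
Proof.
have [_ cC cB cA] := C1_K; have [_ _ cX21 cX22] := C1_mx_submx C1_X.
apply: C1_mxD.
  by apply: C1_mxM; [exact: cX21|exact: C1_mx_cst].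
apply: C1_mxM; last exact: C1_mx_cst.
by apply: C1_mxM; [exact: cX22|exact: C1_mx_tr].
Qed.

Let GKstar : G Kstar = 0.
Proof.
by rewrite /G XKstar block_mxKdl block_mxKdr !mul0mx addr0.
Qed.

Let CKstar : ursubmx Kstar = 0.
Proof. by rewrite block_mxKur. Qed.

(** Near [Kstar] the cost is a constant plus the trace of a product of two factors that vanish at
    [Kstar]. *)
Let derive2_J D1 D2 : derive2_at Kstar J D1 D2
  (\tr (ursubmx D1 *m dmx Kstar D2 G) + \tr (ursubmx D2 *m dmx Kstar D1 G)).
Proof.
have [_ cC _ _] := C1_K.
apply: (near_eq_derive2_at (f := fun K => \tr (Yop *m W) + \tr (ursubmx K *m G K))).
  by apply: filterS near_J => K ->.
rewrite -[X in derive2_at _ _ _ _ X]add0r.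
apply: derive2_atD; first exact: derive2_at_cst.
have := derive2_at_mxtrace D1 D2 cC C1_G CKstar GKstar.
by rewrite !dmx_ursubmx !dmx_id.
Qed.

(** In the product rule for [ursubmx K *m G K], each term keeps a factor that vanishes at
    [Kstar]. *)
Lemma open_loop_stationary : stationary (stab_ctrl A B C) J Kstar.
Proof.
have dJ : differentiable J Kstar.
  by have [C1J _] := derive2_J 0 0; exact: C1_at_differentiable.
split; first exact: open_loop_stab.
split=> //; first by apply/matrixP => i j; rewrite !mxE.
move=> D _; rewrite -deriveE // (near_eq_derive _ near_J).
have [_ cC _ _] := C1_K.
have cCG := C1_mxM cC C1_G.
have -> : 'D_D (fun K => \tr (Yop *m W) + \tr (ursubmx K *m G K)) Kstar =
    'D_D (fun K => \tr (ursubmx K *m G K)) Kstar.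
  rewrite (deriveD (C1_at_derivable (C1_at_cst Kstar _))) ?derive_cst ?add0r //.
  by apply: C1_at_derivable; exact: C1_mxtrace.
rewrite derive_mxtrace // dmxM // CKstar GKstar mulmx0 mul0mx addr0.
by rewrite trmx0 mul0mx !mxtrace0.
Qed.

(* The derivative of the lower left block of the closed-loop covariance [X] at
   [Kstar], in a direction whose [B_K]-component is [BD]. *)
Definition cross_cov (BD : 'M[F]_(n, p)) : 'M[F]_n :=
  syl_sol Lambda A^T (BD *m C *m Xop).

Let uZ : syl_mx Lambda A^T \in unitmx.
Proof. exact: (syl_mx_unit Lambda_stable (stable_tr A_stable)). Qed.

(** Differentiate the lower left block equation. Since [X Kstar] has only its upper left block and
    [Kstar] only [Lambda], what survives is the Sylvester equation of [cross_cov]. *)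
Let dmx_X21 D :
  dmx Kstar D (fun K => dlsubmx (X K)) = cross_cov (dlsubmx D).
Proof.
have [_ cC cB cA] := C1_K; have [cX11 _ cX21 cX22] := C1_mx_submx C1_X.
apply/(syl_solP _ _ uZ).
have nearE : \forall K \near Kstar,
    dlsubmx K *m C *m ulsubmx (X K) + drsubmx K *m dlsubmx (X K) +
    (dlsubmx (X K) *m A^T + drsubmx (X K) *m (B *m ursubmx K)^T) = 0.
  apply: filterS near_syl_unit => K u.
  have eqX : M K *m X K + X K *m (M K)^T + S K = 0 by apply/(syl_solP _ _ u).
  by have [_] := @lyap_blocks _ _ _ _ A B C W _ _ _ _ _ eqX.
have cBC : C1_mx Kstar (fun K => dlsubmx K *m C).
  by apply: C1_mxM; [exact: cB|exact: C1_mx_cst].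
have cBCt : C1_mx Kstar (fun K => (B *m ursubmx K)^T).
  by apply: C1_mx_tr; apply: C1_mxM; [exact: C1_mx_cst|exact: cC].
have cAt : C1_mx Kstar (fun=> A^T) by exact: C1_mx_cst.
have cCc : C1_mx Kstar (fun=> C) by exact: C1_mx_cst.
have c1 := C1_mxM cBC cX11; have c2 := C1_mxM cA cX21.
have c3 := C1_mxM cX21 cAt; have c4 := C1_mxM cX22 cBCt.
have := near_eq_dmx D nearE; rewrite dmx_cst.
rewrite (dmxD D (C1_mxD c1 c2) (C1_mxD c3 c4)) (dmxD D c1 c2) (dmxD D c3 c4).
rewrite (dmxM D cBC cX11) (dmxM D cA cX21) (dmxM D cX21 cAt).
rewrite (dmxM D cX22 cBCt) (dmxM D cB cCc) !dmx_cst.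
have -> : dmx Kstar D (fun K => dlsubmx K) = dlsubmx D.
  by rewrite (dmx_dlsubmx _ _ id) dmx_id.
rewrite XKstar block_mxKul block_mxKdl block_mxKdr.
rewrite /Kstar block_mxKur block_mxKdl block_mxKdr.
rewrite !(mul0mx, mulmx0, trmx0, addr0, add0r).
by move=> h; rewrite -[RHS]h addrC addrA.
Qed.

(** The second summand of [G] contributes nothing: both [drsubmx (X K)] and [ursubmx K] vanish at
    [Kstar]. *)
Let dmx_G D : dmx Kstar D G = cross_cov (dlsubmx D) *m (Yop *m B *+ 2).
Proof.
have [_ cC cB cA] := C1_K; have [cX11 _ cX21 cX22] := C1_mx_submx C1_X.
have cCt := C1_mx_tr cC.
have cY : C1_mx Kstar (fun=> Yop *m B *+ 2) by exact: C1_mx_cst.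
have cR : C1_mx Kstar (fun=> R) by exact: C1_mx_cst.
have cX22C : C1_mx Kstar (fun K => drsubmx (X K) *m (ursubmx K)^T).
  exact: (C1_mxM cX22 cCt).
rewrite (dmxD D (C1_mxM cX21 cY) (C1_mxM cX22C cR)) (dmxM D cX21 cY).
rewrite (dmxM D cX22C cR) (dmxM D cX22 cCt) !dmx_cst dmx_X21.
rewrite CKstar XKstar block_mxKdr.
by rewrite !(mul0mx, mulmx0, trmx0, addr0).
Qed.

Lemma open_loop_hess D1 D2 : hess J Kstar D1 D2 =
  \tr (ursubmx D1 *m (cross_cov (dlsubmx D2) *m (Yop *m B *+ 2))) +
  \tr (ursubmx D2 *m (cross_cov (dlsubmx D1) *m (Yop *m B *+ 2))).
Proof. by rewrite -!dmx_G; have [_ [_]] := derive2_J D1 D2. Qed.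

End OpenLoop.

(** * The Hessian criterion *)

(** This trace is the squared Frobenius norm. *)
Lemma mxtrace_mul_tr_gt0 (F : realDomainType) a b (M : 'M[F]_(a, b)) :
  M != 0 -> 0 < \tr (M^T *m M).
Proof.
have sq_ge0 i : true -> 0 <= (M^T *m M) i i.
  by move=> _; rewrite mxE; apply: sumr_ge0 => k _; rewrite mxE -expr2 sqr_ge0.
rewrite lt0r sumr_ge0 // andbT; apply: contraNneq => /eqP.
rewrite psumr_eq0 // => /allP H; apply/eqP/matrixP => k i.
have := H i (mem_index_enum i); rewrite mxE psumr_eq0 /= => [/allP H'|l _].
  have := H' k (mem_index_enum k).
  by rewrite mxE /= mulf_eq0 orbb => /eqP ->; rewrite mxE.
by rewrite mxE -expr2 sqr_ge0.
Qed.

Lemma mxmulrn2_eq0 (F : numDomainType) a b (M : 'M[F]_(a, b)) :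
  M *+ 2 = 0 -> M = 0.
Proof.
move=> /matrixP H; apply/matrixP => i j; have := H i j.
by rewrite mulr2n !mxE => /eqP; rewrite -mulr2n mulrn_eq0 /= => /eqP.
Qed.

Section Criterion.
Variables (F : realType) (n m p : nat).
Variables (A : 'M[F]_n) (B : 'M[F]_(n, m)) (C : 'M[F]_(p, n)).
Variables (W : 'M[F]_n) (V : 'M[F]_p) (Q : 'M[F]_n) (R : 'M[F]_m).
Variable Lambda : 'M[F]_n.
Hypotheses (symW : W^T = W) (symV : V^T = V) (symQ : Q^T = Q).
Hypotheses (A_stable : stable A) (Lambda_stable : stable Lambda).

Let Kstar : 'M[F]_(m + n, p + n) := block_mx 0 0 0 Lambda.
Let J := @lqg_cost F n m p A B C W V Q R.
Let Xop : 'M[F]_n := syl_sol A A^T W.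
Let Yop : 'M[F]_n := syl_sol A^T A Q.
Let Z (BD : 'M[F]_(n, p)) : 'M[F]_n := cross_cov A C W Lambda BD.
(** The derivative of [G] at [Kstar], as a function of the [B_K]-component of the direction. *)
Let T BD : 'M[F]_(n, m) := Z BD *m (Yop *m B *+ 2).

Let TE BD : T BD = Z BD *m (Yop *m B) *+ 2.
Proof. by rewrite /T !mulr2n mulmxDr. Qed.

Let hessE D1 D2 : hess J Kstar D1 D2 =
  \tr (ursubmx D1 *m T (dlsubmx D2)) + \tr (ursubmx D2 *m T (dlsubmx D1)).
Proof. exact: open_loop_hess. Qed.

Let indefinite_of BD : T BD != 0 -> hess_indefinite J Kstar.
Proof.
move=> /mxtrace_mul_tr_gt0 T0.
(* On these directions the Hessian is plus or minus twice the squared Frobenius norm of [T BD]. *)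
split; [exists (block_mx 0 (T BD)^T BD 0)|exists (block_mx 0 (- (T BD)^T) BD 0)].
- by rewrite /ctrl_space /= block_mxKul.
- by rewrite hessE block_mxKur block_mxKdl addr_gt0.
- by rewrite /ctrl_space /= block_mxKul.
- by rewrite hessE block_mxKur block_mxKdl mulNmx linearN /= -opprD oppr_lt0 addr_gt0.
Qed.

Let zero_of : (forall BD, T BD = 0) -> hess_zero J Kstar.
Proof. by move=> T0 D1 D2 _ _; rewrite hessE !T0 !mulmx0 linear0 addr0. Qed.

Let indefinite_nonzero : hess_indefinite J Kstar -> ~ hess_zero J Kstar.
Proof. by move=> [[D cD D0] _] H; move: D0; rewrite H // ltxx. Qed.

Lemma hess_indefinite_or_zero : hess_indefinite J Kstar \/ hess_zero J Kstar.
Proof.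
have [T0|/existsNP[BD /eqP T0]] := pselect (forall BD, T BD = 0).
  by right; exact: zero_of.
by left; exact: indefinite_of T0.
Qed.

Let hess_zeroP : hess_zero J Kstar <-> forall BD, T BD = 0.
Proof.
split=> [H BD|]; last exact: zero_of.
by apply/eqP; apply: contraPT H => /indefinite_of; exact: indefinite_nonzero.
Qed.

Lemma hess_indefiniteP : hess_indefinite J Kstar <-> ~ hess_zero J Kstar.
Proof.
split; first exact: indefinite_nonzero.
by move=> H; case: hess_indefinite_or_zero.
Qed.

(** * Eigenvectors and the transfer function *)

Let resolvent s := invmx (s%:M - cplx_mx A^T).

(** An eigenvalue of [- Lambda] has positive real part, while those of [A^T] have negative real
    part. *)
Let resolvent_unit s : eig (- Lambda) s -> s%:M - cplx_mx A^T \in unitmx.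
Proof.
move=> es; rewrite -opprB -scaleN1r unitmxZ ?unitrN1 //.
apply: unitmx_sub_eigenvalue; apply/negP => /(stable_tr A_stable) s0.
suff /Lambda_stable : eig Lambda (- s).
  by rewrite raddfN /= oppr_lt0 => s1; have := lt_trans s0 s1; rewrite ltxx.
have /eigenvalueP[v vL v0] := es; apply/eigenvalueP; exists v => //.
by rewrite scaleNr -vL /cplx_mx map_mxN mulmxN opprK.
Qed.

(** Multiplied by [v] on the left, the Sylvester equation of [Z BD] has [Lambda] replaced by the
    scalar [- s], and can be solved with the resolvent of [A^T]. *)
Let mul_eigenvector (v : 'rV[F[i]]_n) s BD :
  v *m cplx_mx (- Lambda) = s *: v -> s%:M - cplx_mx A^T \in unitmx ->
  v *m cplx_mx (Z BD) =
  v *m cplx_mx BD *m (cplx_mx (C *m Xop) *m resolvent s).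
Proof.
move=> vL u.
have uZ := syl_mx_unit Lambda_stable (stable_tr A_stable).
have /(syl_solP _ _ uZ) := erefl (Z BD).
move=> /(congr1 (fun X => v *m cplx_mx X)).
rewrite /cplx_mx !map_mxD !map_mxM map_mx0 mulmx0 -/(cplx_mx _) !mulmxDr !mulmxA.
have -> : v *m map_mx (real_complex F) Lambda = - s *: v.
  by rewrite scaleNr -vL /cplx_mx map_mxN mulmxN opprK.
move=> /eqP; rewrite addrC addr_eq0 => /eqP ->.
rewrite -scalemxAl scaleNr opprD opprK -mul_mx_scalar -mulmxBr.
by rewrite /resolvent mulmxK.
Qed.

(* By [mul_eigenvector], a left eigenvector [v] of [Lambda] turns [T BD] into
   [v *m BD] times twice the transfer function defining [Zset], and [v *m BD] is
   arbitrary up to a nonzero complex scalar. *)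
Lemma hess_zero_eig : diagonalizable (cplx_mx Lambda) ->
  hess_zero J Kstar <-> eig (- Lambda) `<=` Zset A B C Xop Yop.
Proof.
(* [PL] says that the rows of [P] are left eigenvectors of [Lambda], with the entries of [d] as
   eigenvalues. *)
move=> [P Pu /diagonalizable_forPex[d /(simmxP Pu) PL]].
apply: (iff_trans hess_zeroP); split=> [T0 s es|sub BD].
  have u := resolvent_unit es; split=> //.
  have /eigenvalueP[v vL v0] := es.
  have [j vj] : exists j, v 0 j != 0 by apply/rV0Pn.
  apply/row_matrixP => k; rewrite row0.
  (* The choice [BD = delta_mx j k] makes [v *m BD] a nonzero multiple of the [k]-th unit row, which
     isolates row [k] of the transfer function. *)
  have /(congr1 (fun X => v *m cplx_mx X)) : Z (delta_mx j k) *m (Yop *m B) = 0.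
    by apply: mxmulrn2_eq0; rewrite -TE.
  rewrite /cplx_mx map_mxM map_mx0 mulmx0 -/(cplx_mx _) mulmxA.
  rewrite (mul_eigenvector _ vL u) /cplx_mx map_delta_mx.
  have -> : v *m delta_mx j k = v 0 j *: (delta_mx 0 k : 'rV_p).
    apply/rowP => l; rewrite !mxE (bigD1 j) //= big1 => [|i /negPf ij].
      by rewrite !mxE eqxx addr0.
    by rewrite mxE ij mulr0.
  rewrite -!mulmxA -!scalemxAl => /eqP.
  rewrite scaler_eq0 (negPf vj) /= => /eqP <-.
  by rewrite rowE /resolvent !mulmxA.
suff ZYB : cplx_mx (Z BD *m (Yop *m B)) = 0.
  by move/eqP: ZYB; rewrite map_mx_eq0 => /eqP ZYB; rewrite TE ZYB mul0rn.
(* It suffices to test on the rows of the invertible [P], a basis of eigenvectors. *)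
apply: (can_inj (mulKmx Pu)); rewrite mulmx0.
apply/row_matrixP => i; rewrite row0 row_mul.
have vL : row i P *m cplx_mx (- Lambda) = - d 0 i *: row i P.
  rewrite /cplx_mx map_mxN mulmxN -row_mul PL.
  by rewrite row_mul row_diag_mx -scalemxAl -rowE scaleNr.
have [|u H] := sub (- d 0 i).
  apply/eigenvalueP; exists (row i P) => //.
  (* A zero row would put a unit row vector in the left kernel of [P]. *)
  apply: contraTneq Pu => Pi0; rewrite -row_free_unit -kermx_eq0.
  apply/rowV0Pn; exists (delta_mx 0 i); first by apply/sub_kermxP; rewrite -rowE.
  by apply/rV0Pn; exists i; rewrite mxE !eqxx oner_eq0.
rewrite /cplx_mx map_mxM mulmxA (mul_eigenvector _ vL u).
rewrite -[LHS]mulmxA [X in _ *m X](_ : _ = 0); first exact: mulmx0.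
exact: H.
Qed.

End Criterion.

Theorem theorem4p2 (F : realType) (n m p : nat)
    (A : 'M[F]_n) (B : 'M[F]_(n, m)) (C : 'M[F]_(p, n))
    (W : 'M[F]_n) (V : 'M[F]_p) (Q : 'M[F]_n) (R : 'M[F]_m)
    (n_ge1 : (1 <= n)%N) (m_ge1 : (1 <= m)%N) (p_ge1 : (1 <= p)%N)
    (W_psd : psd W) (V_pd : posdef V) (Q_psd : psd Q) (R_pd : posdef R)
    (ctrlAB : controllable A B) (ctrlAW : controllable A (psd_sqrt W))
    (obsCA : observable C A) (obsQA : observable (psd_sqrt Q) A)
    (A_stable : stable A)
    (Lambda : 'M[F]_n) (Lambda_stable : stable Lambda) :
  let J := lqg_cost A B C W V Q R in
  let Kstar : 'M[F]_(m + n, p + n) := block_mx 0 0 0 Lambda in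
  [/\ stationary (stab_ctrl A B C) J Kstar,
      hess_indefinite J Kstar \/ hess_zero J Kstar &
      diagonalizable (cplx_mx Lambda) ->
      forall Xop Yop : 'M[F]_n,
        A *m Xop + Xop *m A^T + W = 0 ->
        A^T *m Yop + Yop *m A + Q = 0 ->
        (hess_indefinite J Kstar <->
           ~ (eig (- Lambda) `<=` Zset A B C Xop Yop)) /\
        (hess_zero J Kstar <->
           eig (- Lambda) `<=` Zset A B C Xop Yop)].
Proof.
move=> J Kstar.
have [symW _] := W_psd; have [symV _] := V_pd; have [symQ _] := Q_psd.
split.
- exact: open_loop_stationary.
- exact: hess_indefinite_or_zero.
- move=> dL Xop Yop eqX eqY.
  have uX := syl_mx_unit A_stable (stable_tr A_stable).
  have uY := syl_mx_unit (stable_tr A_stable) A_stable.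
  (* By uniqueness, the given [Xop] and [Yop] are the solutions given by the formula. *)
  move/(syl_solP _ _ uX): eqX => ->; move/(syl_solP _ _ uY): eqY => ->.
  have zeroE := hess_zero_eig B C R symW symV symQ A_stable Lambda_stable dL.
  split; last exact: zeroE.
  apply: iff_trans (not_iff_compat zeroE).
  exact: hess_indefiniteP.
Qed.
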